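(* Let $N$ be a positive integer and let $k$ be a field. The category of $N$-complexes (of $k$-vector spaces) and the category of $\mathcal{L}_N$-modules are isomorphic.
   Context: An $N$-complex is a $\mathbb{Z}$-graded $k$-vector space $\{{}_iM\}_{i\in\mathbb{Z}}$ together with linear maps $d_i:{}_iM\to{}_{i+1}M$ such that every composition of $N$ consecutive maps is zero: $d_{i+N-1}\circ\dots\circ d_i=0$ for each $i\in\mathbb{Z}$. Morphisms of $N$-complexes are degree-preserving linear maps commuting with the maps $d_i$. For a small $k$-linear category $\mathcal{C}$ with object set $\mathcal{C}_0$, write ${}_y\mathcal{C}_x$ for the $k$-vector space of morphisms from $x$ to $y$. A (left) $\mathcal{C}$-module is a $k$-linear functor from $\mathcal{C}$ to the category of $k$-vector spaces, and morphisms of modules are natural transformations. An ideal $I$ of $\mathcal{C}$ is a collection of subspaces ${}_yI_x\subseteq{}_y\mathcal{C}_x$ stable under left and right composition with arbitrary morphisms of $\mathcal{C}$; the quotient category $\mathcal{C}/I$ has the same objects and morphism spaces ${}_y\mathcal{C}_x/{}_yI_x$. Let $\mathcal{L}$ be the free $k$-category on the quiver with vertex set $\mathbb{Z}$ and exactly one arrow from $i$ to $i+1$ for each $i\in\mathbb{Z}$; thus ${}_j\mathcal{L}_i$ is one-dimensional if $i\le j$ and zero otherwise. Let $I_N$ be the ideal of $\mathcal{L}$ given by ${}_j(I_N)_i={}_j\mathcal{L}_i$ if $j\ge i+N$ and ${}_j(I_N)_i=0$ otherwise. Put $\mathcal{L}_N:=\mathcal{L}/I_N$. *)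

(* Defs.v *)
From HB Require Import structures.
From mathcomp Require Import all_boot all_order all_algebra finmap.
From mathcomp Require Import boolp.
From mathcomp.multinomials Require Import monalg.

Set Implicit Arguments.
Unset Strict Implicit.
Unset Printing Implicit Defensive.

Import Order.TTheory GRing.Theory Num.Theory.
Local Open Scope ring_scope.
Local Open Scope quotient_scope.

#[local] Obligation Tactic := idtac.

Record category := Category {
  ob : Type;
  hom : ob -> ob -> Type;
  idm : forall x, hom x x;
  comp : forall x y z, hom y z -> hom x y -> hom x z;
  compA : forall w x y z (h : hom y z) (g : hom x y) (f : hom w x),
    comp h (comp g f) = comp (comp h g) f;
  comp1m : forall x y (f : hom x y), comp (idm y) f = f;
  compm1 : forall x y (f : hom x y), comp f (idm x) = f }.

Arguments idm {c} x.
Arguments comp {c x y z} g f : rename.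

Record functor (C D : category) := Functor {
  fob :> ob C -> ob D;
  fmor : forall x y, hom x y -> hom (fob x) (fob y);
  fmor1 : forall x, fmor (idm x) = idm (fob x);
  fmorM : forall x y z (g : hom y z) (f : hom x y),
    fmor (comp g f) = comp (fmor g) (fmor f) }.

Arguments fmor {C D} f {x y} : rename.

Definition functor_id (C : category) : functor C C :=
  @Functor C C id (fun _ _ f => f) (fun=> erefl) (fun _ _ _ _ _ => erefl).

Program Definition functor_comp (C D E : category)
    (G : functor D E) (F : functor C D) : functor C E :=
  @Functor C E (fun x => G (F x)) (fun _ _ f => fmor G (fmor F f)) _ _.
Next Obligation. by move=> C D E G F x /=; rewrite !fmor1. Qed.
Next Obligation. by move=> C D E G F x y z g f /=; rewrite !fmorM. Qed.

(* Equality of functors is Leibniz equality: this is isomorphism of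
   categories, which is strictly stronger than equivalence. *)
Definition isomorphic_categories (C D : category) : Prop :=
  exists (F : functor C D) (G : functor D C),
    functor_comp G F = functor_id C /\ functor_comp F G = functor_id D.

Record nat_trans (C D : category) (F G : functor C D) := NatTrans {
  ntr :> forall x, hom (F x) (G x);
  ntr_nat : forall x y (f : hom x y),
    comp (ntr y) (fmor F f) = comp (fmor G f) (ntr x) }.

Lemma nat_trans_eq (C D : category) (F G : functor C D) (a b : nat_trans F G) :
  (forall x, a x = b x) -> a = b.
Proof.
case: a b => [a ha] [b hb] /= ab.
have e : a = b by apply: functional_extensionality_dep.
by subst b; congr NatTrans; apply: Prop_irrelevance.
Qed.

Program Definition nat_trans_id (C D : category) (F : functor C D) :
  nat_trans F F := @NatTrans C D F F (fun x => idm (F x)) _.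
Next Obligation. by move=> C D F x y f /=; rewrite comp1m compm1. Qed.

Program Definition nat_trans_comp (C D : category) (F G H : functor C D)
    (b : nat_trans G H) (a : nat_trans F G) : nat_trans F H :=
  @NatTrans C D F H (fun x => comp (b x) (a x)) _.
Next Obligation.
by move=> C D F G H b a x y f /=; rewrite -compA ntr_nat compA ntr_nat compA.
Qed.

Section VectorSpaces.
Variable k : fieldType.

Lemma linear_fun_eq (U V : lmodType k) (f g : {linear U -> V}) : f =1 g -> f = g.
Proof.
case: f g => [f cf] [g cg] /= fg.
have e : f = g by apply: funext.
subst g; congr GRing.Linear.Pack.
case: cf cg => [[a1] [a2]] [[b1] [b2]].
by rewrite (Prop_irrelevance a1 b1) (Prop_irrelevance a2 b2).
Qed.

Program Definition Vect : category :=
  @Category (lmodType k) (fun U V => {linear U -> V})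
    (fun U => idfun) (fun U V W g f => g \o f) _ _ _.
Next Obligation. by move=> *; apply: linear_fun_eq. Qed.
Next Obligation. by move=> *; apply: linear_fun_eq. Qed.
Next Obligation. by move=> *; apply: linear_fun_eq. Qed.

End VectorSpaces.

Section QuotientSpace.
Variables (k : fieldType) (V : lmodType k) (U : submodClosed V).

(* [Quotient.quot] only provides the additive group V/U; the scalar action
   is added below. *)
Fact submod_oppr_closed : oppr_closed U.
Proof. by move=> v Uv; rewrite -scaleN1r rpredZ. Qed.

Definition submod_zmod : zmodClosed V :=
  HB.pack_for (zmodClosed V) (GRing.SubmodClosed.sort U)
    (GRing.isOppClosed.Build V (GRing.SubmodClosed.sort U) submod_oppr_closed).

Definition lquot : Type := Quotient.quot submod_zmod.

HB.instance Definition _ := GRing.Zmodule.on lquot.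

Definition lquot_pi (v : V) : lquot := \pi_(Quotient.quot submod_zmod) v.
Definition lquot_repr (x : lquot) : V := repr (x : Quotient.quot submod_zmod).

Lemma lquot_reprK x : lquot_pi (lquot_repr x) = x.
Proof. exact: reprK. Qed.

Lemma lquot_eqP u v : reflect (lquot_pi u = lquot_pi v) (u - v \in U).
Proof. by rewrite (Quotient.idealrBE submod_zmod); apply: eqP. Qed.

Lemma lquot_piK v : lquot_repr (lquot_pi v) - v \in U.
Proof. by apply/lquot_eqP; rewrite lquot_reprK. Qed.

Lemma lquot_piD u v : lquot_pi (u + v) = lquot_pi u + lquot_pi v.
Proof. exact: (raddfD (\pi_(Quotient.quot submod_zmod))). Qed.

Definition lquot_scale (a : k) (x : lquot) : lquot := lquot_pi (a *: lquot_repr x).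

Lemma lquot_piZ_def a v : lquot_pi (a *: v) = lquot_scale a (lquot_pi v).
Proof.
apply/lquot_eqP; rewrite -scalerBr rpredZ // -opprB.
exact/submod_oppr_closed/lquot_piK.
Qed.

Fact lquot_scaleA a b x : lquot_scale a (lquot_scale b x) = lquot_scale (a * b) x.
Proof. by rewrite -[x]lquot_reprK -!lquot_piZ_def scalerA. Qed.

Fact lquot_scale1 : left_id 1 lquot_scale.
Proof. by move=> x; rewrite -[x]lquot_reprK -lquot_piZ_def scale1r. Qed.

Fact lquot_scaleDr : right_distributive lquot_scale +%R.
Proof.
move=> a x y; rewrite -[x]lquot_reprK -[y]lquot_reprK -lquot_piD.
by rewrite -!lquot_piZ_def -lquot_piD scalerDr.
Qed.

Fact lquot_scaleDl x : {morph lquot_scale^~ x : a b / a + b}.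
Proof.
by move=> a b; rewrite -[x]lquot_reprK -!lquot_piZ_def -lquot_piD scalerDl.
Qed.

HB.instance Definition _ := GRing.Zmodule_isLmodule.Build k lquot
  lquot_scaleA lquot_scale1 lquot_scaleDr lquot_scaleDl.

Fact lquot_pi_linear : linear lquot_pi.
Proof. by move=> a u v; rewrite lquot_piD lquot_piZ_def. Qed.

HB.instance Definition _ := GRing.isLinear.Build k V lquot *:%R lquot_pi
  lquot_pi_linear.

End QuotientSpace.

Section LinearCategories.
Variable k : fieldType.

(* small k-linear categories: [khom x y] is the space of morphisms from x to y *)
Record klcategory := KLCategory {
  kob : Type;
  khom : kob -> kob -> lmodType k;
  kidm : forall x, khom x x;
  kcomp : forall x y z, khom y z -> khom x y -> khom x z;
  kcompA : forall w x y z (h : khom y z) (g : khom x y) (f : khom w x),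
    kcomp h (kcomp g f) = kcomp (kcomp h g) f;
  kcomp1m : forall x y (f : khom x y), kcomp (kidm y) f = f;
  kcompm1 : forall x y (f : khom x y), kcomp f (kidm x) = f;
  kcomp_linl : forall x y z (f : khom x y),
    linear (fun g : khom y z => kcomp g f);
  kcomp_linr : forall x y z (g : khom y z),
    linear (fun f : khom x y => kcomp g f) }.

Arguments kidm {k} x : rename.
Arguments kcomp {k x y z} g f : rename.

Lemma kcomp0l (C : klcategory) (x y z : kob C) (f : khom x y) :
  kcomp (0 : khom y z) f = 0.
Proof. by rewrite -(subrr 0) addrC -scaleN1r (kcomp_linl f) scaleN1r addNr. Qed.

Lemma kcomp0r (C : klcategory) (x y z : kob C) (g : khom y z) :
  kcomp g (0 : khom x y) = 0.
Proof. by rewrite -(subrr 0) addrC -scaleN1r (kcomp_linr g) scaleN1r addNr. Qed.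

Definition category_of (C : klcategory) : category :=
  Category (@kcompA C) (@kcomp1m C) (@kcompm1 C).

(* The hom-spaces of [Vect k] carry no vector space structure here, so
   linearity of the functor on morphisms is stated pointwise. *)
Record kmodule (C : klcategory) := KModule {
  kmod_fun :> functor (category_of C) (Vect k);
  kmod_lin : forall (x y : kob C) (v : kmod_fun x),
    linear (fun f : khom x y => (fmor kmod_fun f : {linear _ -> _}) v) }.

Program Definition Mod (C : klcategory) : category :=
  @Category (kmodule C) (fun M M' => nat_trans M M')
    (fun M => nat_trans_id M) (fun _ _ _ b a => nat_trans_comp b a) _ _ _.
Next Obligation. by move=> *; apply: nat_trans_eq => x; apply: linear_fun_eq. Qed.
Next Obligation. by move=> *; apply: nat_trans_eq => x; apply: linear_fun_eq. Qed.
Next Obligation. by move=> *; apply: nat_trans_eq => x; apply: linear_fun_eq. Qed.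

Record kideal (C : klcategory) := KIdeal {
  kid_mem :> forall x y : kob C, submodClosed (khom x y);
  kid_compl : forall (x y z : kob C) (g : khom y z) (f : khom x y),
    f \in kid_mem x y -> kcomp g f \in kid_mem x z;
  kid_compr : forall (x y z : kob C) (g : khom y z) (f : khom x y),
    g \in kid_mem y z -> kcomp g f \in kid_mem x z }.

Section QuotientCategory.
Variables (C : klcategory) (I : kideal C).

Definition quot_hom (x y : kob C) : lmodType k := lquot (I x y).
Definition quot_comp x y z (g : quot_hom y z) (f : quot_hom x y) : quot_hom x z :=
  lquot_pi (I x z) (kcomp (lquot_repr g) (lquot_repr f)).

Lemma quot_compE x y z (g : khom y z) (f : khom x y) :
  quot_comp (lquot_pi (I y z) g) (lquot_pi (I x y) f) = lquot_pi (I x z) (kcomp g f).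
Proof.
apply/lquot_eqP; set g' := lquot_repr _; set f' := lquot_repr _.
have -> : kcomp g' f' - kcomp g f = kcomp (g' - g) f' + kcomp g (f' - f).
  have dl : kcomp (g' - g) f' = kcomp g' f' - kcomp g f'.
    by rewrite addrC -scaleN1r (kcomp_linl f') scaleN1r addrC.
  have dr : kcomp g (f' - f) = kcomp g f' - kcomp g f.
    by rewrite addrC -scaleN1r (kcomp_linr g) scaleN1r addrC.
  by rewrite dl dr addrA subrK.
by apply: rpredD; [apply: kid_compr | apply: kid_compl]; apply: lquot_piK.
Qed.

Program Definition quotient_category : klcategory :=
  @KLCategory (kob C) quot_hom (fun x => lquot_pi (I x x) (kidm x)) quot_comp
    _ _ _ _ _.
Next Obligation.
move=> w x y z h g f; rewrite -[h]lquot_reprK -[g]lquot_reprK -[f]lquot_reprK.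
by rewrite !quot_compE kcompA.
Qed.
Next Obligation.
by move=> x y f; rewrite -[f]lquot_reprK quot_compE kcomp1m.
Qed.
Next Obligation.
by move=> x y f; rewrite -[f]lquot_reprK quot_compE kcompm1.
Qed.
Next Obligation.
move=> x y z f a g g'; rewrite -[f]lquot_reprK -[g]lquot_reprK -[g']lquot_reprK.
by rewrite -linearP !quot_compE kcomp_linl linearP.
Qed.
Next Obligation.
move=> x y z g a f f'; rewrite -[g]lquot_reprK -[f]lquot_reprK -[f']lquot_reprK.
by rewrite -linearP !quot_compE kcomp_linr linearP.
Qed.

End QuotientCategory.
End LinearCategories.

Arguments kidm {k k0} x : rename.
Arguments kcomp {k k0 x y z} g f : rename.

Record quiver := Quiver { qvertex : Type; qarrow : qvertex -> qvertex -> Type }.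

Inductive qpath (Q : quiver) (x : qvertex Q) : qvertex Q -> Type :=
| QNil : qpath x x
| QCons y z of qpath x y & qarrow y z : qpath x z.

Arguments QNil {Q x}.
Arguments QCons {Q x y z} p a.

(* [qcat p q] runs through [p] first, then through [q] *)
Fixpoint qcat (Q : quiver) (x y z : qvertex Q) (p : qpath x y) (q : qpath y z) :
    qpath x z :=
  match q with
  | QNil => p
  | QCons _ _ q' a => QCons (qcat p q') a
  end.

Lemma qcatA (Q : quiver) (w x y z : qvertex Q)
    (p : qpath w x) (q : qpath x y) (r : qpath y z) :
  qcat p (qcat q r) = qcat (qcat p q) r.
Proof. by elim: r => //= y' z' r -> a. Qed.

Lemma qcat0p (Q : quiver) (x y : qvertex Q) (p : qpath x y) : qcat QNil p = p.
Proof. by elim: p => //= y' z' p -> a. Qed.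

Section LinearExtension.
Variables (k : fieldType) (K : choiceType) (V : lmodType k).

(* {malg k[K]} is the free vector space on K; [lext h] is the linear map
   extending h : K -> V. *)
Definition lext (h : K -> V) (g : {malg k[K]}) : V :=
  \sum_(p <- msupp g) g@_p *: h p.

Lemma lextEw h g (d : {fset K}) : (msupp g `<=` d)%fset ->
  lext h g = \sum_(p <- d) g@_p *: h p.
Proof.
move=> le; rewrite /lext (big_fset_incl _ le) // => p _ pg.
by rewrite mcoeff_outdom // scale0r.
Qed.

Lemma lext_linear h : linear (lext h).
Proof.
move=> a f g; set d := (msupp (a *: f + g) `|` (msupp f `|` msupp g))%fset.
rewrite !(@lextEw _ _ d) ?fsubsetUl //; last first.
- by rewrite /d fsetUCA fsubsetUl.
- by rewrite /d fsetUA fsubsetUr.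
rewrite scaler_sumr -big_split /=; apply: eq_bigr => p _.
by rewrite mcoeffD mcoeffZ scalerDl scalerA.
Qed.

HB.instance Definition _ h := GRing.isLinear.Build k {malg k[K]} V *:%R (lext h)
  (lext_linear h).

Lemma lextU h p : lext h << p >> = h p.
Proof.
by rewrite (@lextEw _ _ [fset p]%fset) ?msuppU_le // big_seq_fset1 mcoeffUU scale1r.
Qed.

Lemma malg_linear_ext (f g : {malg k[K]} -> V) : linear f -> linear g ->
  (forall p, f << p >> = g << p >>) -> f =1 g.
Proof.
move=> lf lg fg m.
pose F : {linear _ -> _} := HB.pack f (GRing.isLinear.Build _ _ _ _ f lf).
pose G : {linear _ -> _} := HB.pack g (GRing.isLinear.Build _ _ _ _ g lg).
rewrite -[f]/(F : _ -> _) -[g]/(G : _ -> _) (monalgE m) !linear_sum /=.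
apply: eq_bigr => p _; have -> : << m@_p *g p >> = m@_p *: << p >> :> {malg k[K]}.
  by apply/malgP => q; rewrite mcoeffZ !mcoeffU mulrnAr mulr1.
by rewrite -[f]/(F : _ -> _) -[g]/(G : _ -> _) !linearZ /= fg.
Qed.

End LinearExtension.

Section FreeCategory.
Variables (k : fieldType) (Q : quiver).

(* {classic _} only supplies the choiceType structure that malg requires. *)
Definition free_hom (x y : qvertex Q) : lmodType k := {malg k[{classic qpath x y}]}.

Definition free_comp x y z (g : free_hom y z) (f : free_hom x y) : free_hom x z :=
  lext (fun q : {classic qpath y z} =>
    lext (fun p : {classic qpath x y} =>
      << (qcat p q : {classic qpath x z}) >> : free_hom x z) f) g.

Definition free_idm x : free_hom x x := << (QNil : {classic qpath x x}) >>.

Lemma free_compE x y z (q : qpath y z) (p : qpath x y) :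
  free_comp << (q : {classic qpath y z}) >> << (p : {classic qpath x y}) >>
  = << (qcat p q : {classic qpath x z}) >> :> free_hom x z.
Proof. by rewrite /free_comp !lextU. Qed.

Fact free_comp_linl x y z (f : free_hom x y) :
  linear (fun g : free_hom y z => free_comp g f).
Proof. exact: lext_linear. Qed.

Fact free_comp_linr x y z (g : free_hom y z) :
  linear (fun f : free_hom x y => free_comp g f).
Proof.
move=> a f f'; rewrite /free_comp; set u := fun q => lext _ (a *: f + f').
rewrite /lext scaler_sumr -big_split /=; apply: eq_bigr => q _.
by rewrite /u lext_linear scalerDr !scalerA mulrC.
Qed.

Fact free_comp1m x y (f : free_hom x y) : free_comp (free_idm y) f = f.
Proof.
apply: (malg_linear_ext (g := id)) f => // [|p]; first exact: free_comp_linr.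
by rewrite free_compE.
Qed.

Fact free_compm1 x y (f : free_hom x y) : free_comp f (free_idm x) = f.
Proof.
apply: (malg_linear_ext (f := fun f => free_comp f _) (g := id)) f => // [|p].
  exact: free_comp_linl.
by rewrite free_compE qcat0p.
Qed.

Fact free_compA w x y z (h : free_hom y z) (g : free_hom x y) (f : free_hom w x) :
  free_comp h (free_comp g f) = free_comp (free_comp h g) f.
Proof.
move: h; apply: malg_linear_ext => [a h h'|a h h'|r].
- exact: free_comp_linl.
- by rewrite !free_comp_linl.
move: g; apply: malg_linear_ext => [a g g'|a g g'|q].
- by rewrite free_comp_linl free_comp_linr.
- by rewrite free_comp_linr free_comp_linl.
move: f; apply: malg_linear_ext => [a f f'|a f f'|p].
- by rewrite !free_comp_linr.
- exact: free_comp_linr.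
by rewrite !free_compE qcatA.
Qed.

Definition free_klcategory : klcategory k :=
  KLCategory free_compA free_comp1m free_compm1 free_comp_linl free_comp_linr.

End FreeCategory.

Inductive succ_arrow : int -> int -> Type := SuccArrow i : succ_arrow i (i + 1).

Definition line_quiver : quiver := Quiver succ_arrow.

Definition Lcat (k : fieldType) : klcategory k := free_klcategory k line_quiver.

Lemma line_path_le (i j : int) : @qpath line_quiver i j -> i <= j.
Proof.
elim=> // y z _ le_iy a; case: a le_iy => w le_iw.
by apply: le_trans le_iw _; rewrite lerDl.
Qed.

Lemma Lcat_hom0 (k : fieldType) (i j : kob (Lcat k)) (f : khom i j) :
  j < i -> f = 0.
Proof.
move=> ji; apply/malgP => p; rewrite mcoeff0.
by have := line_path_le p; rewrite leNgt ji.
Qed.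

Section IdealIN.
Variables (k : fieldType) (N : nat).

Definition IN_mem (i j : kob (Lcat k)) (f : khom i j) : bool :=
  if (i : int) + N%:Z <= j then true else f == 0.

Fact IN_submod_closed i j : subsemimod_closed (@IN_mem i j).
Proof.
split=> [|a f]; first split=> [|f g]; rewrite !unfold_in /IN_mem; case: ifP => // _.
- by move=> /eqP -> /eqP ->; rewrite addr0.
- by move=> /eqP ->; rewrite scaler0.
Qed.

Definition IN_submod i j : submodClosed (khom i j) :=
  HB.pack_for (submodClosed (khom i j)) (@IN_mem i j)
    (GRing.isSubmodClosed.Build k (khom i j) (@IN_mem i j) (@IN_submod_closed i j)).

Lemma IN_submodE i j (f : khom i j) : (f \in IN_submod i j) = IN_mem f.
Proof. by []. Qed.

Program Definition IN : kideal (Lcat k) := @KIdeal k (Lcat k) IN_submod _ _.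
Next Obligation.
move=> i j l g f; rewrite !IN_submodE /IN_mem; case: ifP => [ij _|_ /eqP ->].
  case: (leP (j : int) l) => [jl|lj]; first by rewrite (le_trans ij jl).
  by rewrite (Lcat_hom0 g lj) kcomp0l eqxx if_same.
by rewrite kcomp0r eqxx if_same.
Qed.
Next Obligation.
move=> i j l g f; rewrite !IN_submodE /IN_mem; case: ifP => [jl _|_ /eqP ->].
  case: (leP (i : int) j) => [ij|ji].
    by rewrite (le_trans _ jl) // lerD2r.
  by rewrite (Lcat_hom0 f ji) kcomp0r eqxx if_same.
by rewrite kcomp0l eqxx if_same.
Qed.

Definition LN : klcategory k := quotient_category IN.

End IdealIN.

Section NComplexes.
Variable k : fieldType.

(* [iter_diff d n i] is d_{i+n-1} o ... o d_i; the target index is the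
   [n]-fold successor of [i] rather than [i + n], so that no cast is needed. *)
Fixpoint iter_diff (M : int -> lmodType k)
    (d : forall i, {linear M i -> M (i + 1)}) (n : nat) (i : int) :
    M i -> M (iter n (fun j => j + 1) i) :=
  match n with
  | 0 => id
  | n'.+1 => fun v => d _ (iter_diff d n' v)
  end.

Record ncomplex (N : nat) := NComplex {
  nc_ob :> int -> lmodType k;
  nc_d : forall i, {linear nc_ob i -> nc_ob (i + 1)};
  nc_dN : forall i (v : nc_ob i), iter_diff nc_d N v = 0 }.

Record ncomplex_hom (N : nat) (M M' : ncomplex N) := NComplexHom {
  nch :> forall i, {linear M i -> M' i};
  nch_d : forall i (v : M i), nch (i + 1) (nc_d M i v) = nc_d M' i (nch i v) }.

Lemma ncomplex_hom_eq (N : nat) (M M' : ncomplex N) (f g : ncomplex_hom M M') :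
  (forall i, f i =1 g i) -> f = g.
Proof.
case: f g => [f hf] [g hg] /= fg.
have e : f = g.
  by apply: functional_extensionality_dep => i; apply/linear_fun_eq/fg.
by subst g; congr NComplexHom; apply: Prop_irrelevance.
Qed.

Program Definition ncomplex_id (N : nat) (M : ncomplex N) : ncomplex_hom M M :=
  @NComplexHom N M M (fun i => idfun) _.
Next Obligation. by []. Qed.

Program Definition ncomplex_comp (N : nat) (M1 M2 M3 : ncomplex N)
    (g : ncomplex_hom M2 M3) (f : ncomplex_hom M1 M2) : ncomplex_hom M1 M3 :=
  @NComplexHom N M1 M3 (fun i => g i \o f i) _.
Next Obligation. by move=> N M1 M2 M3 g f i v /=; rewrite !nch_d. Qed.

Program Definition NComplexes (N : nat) : category :=
  @Category (ncomplex N) (fun M M' => ncomplex_hom M M')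
    (fun M => ncomplex_id M) (fun _ _ _ g f => ncomplex_comp g f) _ _ _.
Next Obligation. by move=> *; apply: ncomplex_hom_eq. Qed.
Next Obligation. by move=> *; apply: ncomplex_hom_eq. Qed.
Next Obligation. by move=> *; apply: ncomplex_hom_eq. Qed.

End NComplexes.

(* Main.v *)
(** There is exactly one path i -> j in the line quiver when i <= j, and none
    otherwise.  Hence maps d_i : M_i -> M_(i+1) let every path act, and by linear
    extension every morphism of the free category; since a path of length at
    least N factors through N consecutive arrows, this action kills I_N exactly
    because M is an N-complex, and descends to the quotient.  Conversely an
    L_N-module is restricted to the arrows i -> i+1.  Neither passage changes the
    underlying spaces or linear maps, so the composites are equal to the
    identities, not merely isomorphic to them. *)
From HB Require Import structures.
From mathcomp Require Import all_boot all_order all_algebra.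
From mathcomp Require Import boolp.
From mathcomp.multinomials Require Import monalg.
Require Import Defs.

Set Implicit Arguments.
Unset Strict Implicit.
Unset Printing Implicit Defensive.

Import Order.TTheory GRing.Theory Num.Theory.
Local Open Scope ring_scope.

#[local] Obligation Tactic := idtac.

(** * Equality of functors *)

(** Needed because equal object maps do not by themselves give the two values of a morphism the same
    type. *)
Definition hom_cast (C : category) (x x' y y' : ob C) (ex : x = x') (ey : y = y')
    (f : hom x y) : hom x' y' :=
  eq_rect y (hom x') (eq_rect x (fun a => hom a y) f x' ex) y' ey.

(** Once the object maps are identified, each [e x] is a loop, hence [erefl] by proof irrelevance,
    and the casts disappear. *)
Lemma functor_eq (C D : category) (F G : functor C D) (e : forall x, F x = G x) :
  (forall x y (f : hom x y), hom_cast (e x) (e y) (fmor F f) = fmor G f) -> F = G.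
Proof.
case: F G e => [F0 F1 F2 F3] [G0 G1 G2 G3] /= e FG.
have e0 : F0 = G0 by apply: functional_extensionality_dep.
subst G0.
have e1 : F1 = G1.
  apply: functional_extensionality_dep => x.
  apply: functional_extensionality_dep => y.
  apply: functional_extensionality_dep => f.
  by rewrite -FG (Prop_irrelevance (e x) erefl) (Prop_irrelevance (e y) erefl).
by subst G1; congr Functor; apply: Prop_irrelevance.
Qed.

Lemma ncomplex_eq (k : fieldType) (N : nat) (A : int -> lmodType k)
    (d d' : forall i, {linear A i -> A (i + 1)}) dN dN' :
  (forall i, d i =1 d' i) -> @NComplex k N A d dN = @NComplex k N A d' dN'.
Proof.
move=> dd'; have e : d = d'.
  by apply: functional_extensionality_dep => i; apply/linear_fun_eq/dd'.
by subst d'; congr NComplex; apply: Prop_irrelevance.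
Qed.

Lemma kmodule_eq (k : fieldType) (C : klcategory k) (M M' : kmodule C) :
  kmod_fun M = kmod_fun M' -> M = M'.
Proof.
case: M M' => [F l] [F' l'] /= e.
by subst F'; congr KModule; apply: Prop_irrelevance.
Qed.

Lemma linear_fun0 (k : fieldType) (U V : lmodType k) (f : U -> V) :
  linear f -> f 0 = 0.
Proof. by move/(_ (-1) 0 0); rewrite scaler0 addr0 scaleN1r addNr. Qed.

Definition ob_cast (k : fieldType) (U V : lmodType k) (e : U = V) : U -> V :=
  eq_rect U (fun W : lmodType k => U -> W) id V e.

(* Applied to the equations [G (F M) = M], whose two sides have convertible
   underlying spaces, although the equations themselves are not [erefl]. *)
Lemma ob_cast_id (k : fieldType) (U : lmodType k) (e : U = U) (v : U) :
  ob_cast e v = v.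
Proof. by rewrite (Prop_irrelevance e erefl). Qed.

(** Stated for arbitrary endpoints so that both equations can be eliminated. It is later used at
    endpoints with convertible spaces, where [ob_cast_id] removes the casts. *)
Lemma hom_cast_ncomplex (k : fieldType) (N : nat) (M1 M1' M2 M2' : ncomplex k N)
    (e1 : M1 = M1') (e2 : M2 = M2') (f : ncomplex_hom M1 M2) i (v : M1 i) :
  nch (@hom_cast (NComplexes k N) _ _ _ _ e1 e2 f) i
    (ob_cast (congr1 (fun M : ncomplex k N => M i) e1) v)
  = ob_cast (congr1 (fun M : ncomplex k N => M i) e2) (f i v).
Proof. by case: M1' / e1; case: M2' / e2. Qed.

Lemma hom_cast_kmodule (k : fieldType) (C : klcategory k) (M1 M1' M2 M2' : kmodule C)
    (e1 : M1 = M1') (e2 : M2 = M2') (f : nat_trans M1 M2) (x : kob C)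
    (v : (M1 x : lmodType k)) :
  (ntr (@hom_cast (Mod C) _ _ _ _ e1 e2 f) x : {linear _ -> _})
    (ob_cast (congr1 (fun M : kmodule C => M x : lmodType k) e1) v)
  = ob_cast (congr1 (fun M : kmodule C => M x : lmodType k) e2)
      ((f x : {linear _ -> _}) v).
Proof. by case: M1' / e1; case: M2' / e2. Qed.

(** * Paths in the line quiver *)

Notation lpath := (@qpath line_quiver).

(** Inversion with explicit equations on endpoints: it still applies when [j] is a fixed expression
    such as [y + 1], and the equations then collapse since [int] has decidable equality. *)
Lemma line_pathP (i j : int) (p : lpath i j) :
  (exists e : i = j, p = eq_rect i (lpath i) QNil j e) \/
  (exists y (q : lpath i y) (e : y + 1 = j),
     p = eq_rect (y + 1) (lpath i) (QCons q (SuccArrow y)) j e).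
Proof.
case: p => [|y z q a]; first by left; exists erefl.
right; exists y; move: q; case: z / a => w q.
by exists q, erefl.
Qed.

Lemma no_backward_path (i : int) : lpath (i + 1) i -> False.
Proof. by move/line_path_le; rewrite gerDl ler10. Qed.

(** Induction on the last arrow, which is determined by its target. An empty path cannot share its
    ends with a nonempty one, as this would yield a path from [i + 1] to [i]. *)
Lemma line_path_unique (i j : int) (p q : lpath i j) : p = q.
Proof.
elim: p q => [|y z p IH a] q.
  case: (line_pathP q) => [[e ->]|[y [q' [e _]]]].
    by rewrite (eq_irrelevance e erefl).
  by exfalso; subst i; apply: no_backward_path q'.
move: p IH q; case: z / a => y' p IH q.
case: (line_pathP q) => [[e _]|[w [q' [e ->]]]].
  by exfalso; subst i; apply: no_backward_path p.
have e' : w = y' by apply: (addIr 1).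
by subst w; rewrite (eq_irrelevance e erefl) (IH q').
Qed.

Fixpoint line_path (n : nat) (i : int) : lpath i (iter n (fun j => j + 1) i) :=
  match n with
  | 0 => QNil
  | n'.+1 => QCons (line_path n' i) (SuccArrow _)
  end.

Definition arrow_path (i : int) : lpath i (i + 1) := line_path 1 i.

Lemma iter_succz n (i : int) : iter n (fun j => j + 1) i = i + n%:Z.
Proof. by elim: n => [|n /= ->]; rewrite ?addr0 // -addrA -PoszD addn1. Qed.

Lemma line_path_exists (i j : int) : i <= j -> exists p : lpath i j, True.
Proof.
move=> le; have <- : iter `|j - i|%N (fun l => l + 1) i = j.
  by rewrite iter_succz gez0_abs ?subr_ge0 // subrKC.
by exists (line_path _ i).
Qed.

(** Any path completing [line_path n i] up to [j] will do, by uniqueness of paths. *)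
Lemma line_path_split (n : nat) (i j : int) (p : lpath i j) : i + n%:Z <= j ->
  exists q : lpath (iter n (fun l => l + 1) i) j, p = qcat (line_path n i) q.
Proof.
rewrite -iter_succz => /line_path_exists[q _].
by exists q; apply: line_path_unique.
Qed.

(** * Action of the free category on a sequence of linear maps *)

Section PathAction.
Variables (k : fieldType) (M : int -> lmodType k).
Variable d : forall i, {linear M i -> M (i + 1)}.

Definition arrow_act (i j : int) (a : succ_arrow i j) : {linear M i -> M j} :=
  match a in succ_arrow i j return {linear M i -> M j} with
  | SuccArrow i => d i
  end.

Fixpoint path_act (i j : int) (p : lpath i j) : {linear M i -> M j} :=
  match p in qpath _ j return {linear M i -> M j} with
  | QNil => idfun
  | QCons y z q a => arrow_act a \o path_act q
  end.

Lemma path_act_cat (i j l : int) (p : lpath i j) (q : lpath j l) v :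
  path_act (qcat p q) v = path_act q (path_act p v).
Proof. by elim: q => //= y z q -> a. Qed.

Lemma path_act_line n i v : path_act (line_path n i) v = iter_diff d n v.
Proof. by elim: n => //= n ->. Qed.

Definition Lact (i j : int) (f : free_hom k (Q:=line_quiver) i j) (v : M i) : M j :=
  lext (fun p : {classic lpath i j} => path_act p v) f.

Lemma Lact_linearl i j v : linear (fun f => @Lact i j f v).
Proof. exact: lext_linear. Qed.

Lemma Lact_linearr i j f : linear (@Lact i j f).
Proof.
move=> a u v; rewrite /Lact /lext scaler_sumr -big_split /=.
by apply: eq_bigr => p _; rewrite linearP scalerDr !scalerA mulrC.
Qed.

HB.instance Definition _ i j f := GRing.isLinear.Build k (M i) (M j) *:%R
  (@Lact i j f) (@Lact_linearr i j f).

Lemma LactU i j (p : lpath i j) v :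
  Lact << (p : {classic lpath i j}) >> v = path_act p v.
Proof. by rewrite /Lact lextU. Qed.

Lemma Lact1 i v : Lact (free_idm k (Q:=line_quiver) i) v = v.
Proof. exact: LactU. Qed.

(** Both sides are linear in [g] and in [f], so it suffices to compare them on paths. *)
Lemma Lact_comp i j l (g : free_hom k (Q:=line_quiver) j l) (f : free_hom k i j) v :
  Lact (free_comp g f) v = Lact g (Lact f v).
Proof.
move: g; apply: malg_linear_ext => [a g g'|a g g'|q].
- by rewrite free_comp_linl Lact_linearl.
- exact: Lact_linearl.
move: f; apply: malg_linear_ext => [a f f'|a f f'|p].
- by rewrite free_comp_linr Lact_linearl.
- by rewrite Lact_linearl linearP.
by rewrite free_compE !LactU path_act_cat.
Qed.

End PathAction.

Lemma path_act_nat (k : fieldType) (M M' : int -> lmodType k)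
    (d : forall i, {linear M i -> M (i + 1)})
    (d' : forall i, {linear M' i -> M' (i + 1)})
    (h : forall i, {linear M i -> M' i}) :
    (forall i v, h (i + 1) (d i v) = d' i (h i v)) ->
  forall i j (p : lpath i j) v, h j (path_act d p v) = path_act d' p (h i v).
Proof.
move=> hd i j; elim=> //= y z p IH a v; rewrite -IH.
by move: p IH; case: z / a => y' p _; apply: hd.
Qed.

Lemma Lact_nat (k : fieldType) (M M' : int -> lmodType k)
    (d : forall i, {linear M i -> M (i + 1)})
    (d' : forall i, {linear M' i -> M' (i + 1)})
    (h : forall i, {linear M i -> M' i}) :
    (forall i v, h (i + 1) (d i v) = d' i (h i v)) ->
  forall i j (f : free_hom k (Q:=line_quiver) i j) v,
    h j (Lact d f v) = Lact d' f (h i v).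
Proof.
move=> hd i j f v; rewrite /Lact /lext linear_sum.
by apply: eq_bigr => p _; rewrite linearZ /= (path_act_nat hd).
Qed.

(** * From N-complexes to modules *)

Section ModuleOfComplex.
Variables (k : fieldType) (N : nat).

Lemma Lact_IN (M : ncomplex k N) i j (f : free_hom k (Q:=line_quiver) i j) v :
  f \in IN k N i j -> Lact (nc_d M) f v = 0.
Proof.
rewrite [_ \in _]IN_submodE /IN_mem; case: ifP => [le _|_ /eqP ->].
  rewrite /Lact /lext big1 // => p _.
  (* The first [N] arrows of [p] already act as the [N]-fold differential, which is zero. *)
  have [q ->] := line_path_split p le.
  by rewrite path_act_cat path_act_line nc_dN linear0 scaler0.
exact: linear0.
Qed.

Section Object.
Variable M : ncomplex k N.

Definition LNact (i j : int) (f : lquot (IN k N i j)) : M i -> M j :=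
  Lact (nc_d M) (lquot_repr f).

HB.instance Definition _ i j f := GRing.Linear.copy (@LNact i j f)
  (Lact (nc_d M) (lquot_repr f)).

(** Independence of the representative: two choices differ by an element of [IN], which acts as
    zero. *)
Lemma LNact_pi i j (f : khom i j) v :
  LNact (lquot_pi (IN k N i j) f) v = Lact (nc_d M) f v.
Proof.
have := Lact_IN (M := M) v (lquot_piK (IN k N i j) f).
rewrite addrC -scaleN1r Lact_linearl scaleN1r => /eqP.
by rewrite addrC subr_eq0 => /eqP.
Qed.

Program Definition module_functor : functor (category_of (LN k N)) (Vect k) :=
  @Functor (category_of (LN k N)) (Vect k) M (fun i j f => @LNact i j f) _ _.
Next Obligation.
by move=> i; apply: linear_fun_eq => v; rewrite /= LNact_pi Lact1.
Qed.
Next Obligation.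
move=> i j l g f; apply: linear_fun_eq => v /=.
rewrite -[g]lquot_reprK -[f]lquot_reprK [quot_comp _ _]quot_compE.
by rewrite !LNact_pi -Lact_comp.
Qed.

Program Definition module_of_ncomplex : kmodule (LN k N) :=
  @KModule k (LN k N) module_functor _.
Next Obligation.
move=> i j v a f g /=; rewrite -[f]lquot_reprK -[g]lquot_reprK -linearP.
by rewrite !LNact_pi Lact_linearl.
Qed.

End Object.

Program Definition module_hom_of_ncomplex (M M' : ncomplex k N)
    (h : ncomplex_hom M M') :
    nat_trans (module_of_ncomplex M) (module_of_ncomplex M') :=
  @NatTrans _ _ (module_of_ncomplex M) (module_of_ncomplex M') (fun i => h i) _.
Next Obligation.
move=> M M' h i j f; apply: linear_fun_eq => v.
exact: (Lact_nat (@nch_d _ _ _ _ h)).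
Qed.

Program Definition to_module : functor (NComplexes k N) (Mod (LN k N)) :=
  @Functor (NComplexes k N) (Mod (LN k N)) module_of_ncomplex
    (fun M M' h => module_hom_of_ncomplex h) _ _.
Next Obligation. by move=> M; apply: nat_trans_eq => i; apply: linear_fun_eq. Qed.
Next Obligation. by move=> *; apply: nat_trans_eq => i; apply: linear_fun_eq. Qed.

End ModuleOfComplex.

(** * From modules to N-complexes *)

Section ComplexOfModule.
Variables (k : fieldType) (N : nat).

Definition LNpath (i j : int) (p : lpath i j) : lquot (IN k N i j) :=
  lquot_pi (IN k N i j) << (p : {classic lpath i j}) >>.

Lemma LNpath_cat i j l (p : lpath i j) (q : lpath j l) :
  LNpath (qcat p q) = quot_comp (LNpath q) (LNpath p).
Proof. by rewrite /LNpath quot_compE /= free_compE. Qed.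

Lemma LNpath0 i j (p : lpath i j) : i + N%:Z <= j -> LNpath p = 0.
Proof.
move=> le; rewrite -(linear0 (lquot_pi (IN k N i j))).
by apply/lquot_eqP; rewrite [_ \in _]IN_submodE /IN_mem le.
Qed.

Section Object.
Variable M : kmodule (LN k N).

Definition module_diff (i : int) :
    {linear (M i : lmodType k) -> (M (i + 1) : lmodType k)} :=
  fmor M (LNpath (arrow_path i) : @hom (category_of (LN k N)) i (i + 1)).

(** A module is determined on paths by its arrows: functoriality peels off the last arrow at each
    step. *)
Lemma path_act_module i j (p : lpath i j) (v : (M i : lmodType k)) :
  path_act module_diff p v
  = (fmor M (LNpath p : @hom (category_of (LN k N)) i j) : {linear _ -> _}) v.
Proof.
elim: p => [|y z p IH a] /=.
  by rewrite [fmor _ _](fmor1 M i).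
rewrite IH; move: p {IH}; case: z / a => y' p /=.
have -> : LNpath (QCons p (SuccArrow y'))
  = @comp (category_of (LN k N)) _ _ _ (LNpath (arrow_path y')) (LNpath p).
  exact: LNpath_cat p (arrow_path y').
by rewrite fmorM.
Qed.

Program Definition ncomplex_of_module : ncomplex k N :=
  @NComplex k N (fun i => M i) module_diff _.
Next Obligation.
(* The [N]-fold differential is the action of the class of a path of length [N]. This class is zero
   in the quotient, and [kmod_lin] makes zero act as zero. *)
move=> i v; rewrite -path_act_line path_act_module LNpath0 ?iter_succz //.
exact: linear_fun0 (@kmod_lin _ _ M i (i + N%:Z) v).
Qed.

End Object.

Program Definition ncomplex_hom_of_module (M M' : kmodule (LN k N))
    (h : nat_trans M M') : ncomplex_hom (ncomplex_of_module M) (ncomplex_of_module M') :=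
  @NComplexHom k N (ncomplex_of_module M) (ncomplex_of_module M') (fun i => h i) _.
Next Obligation.
move=> M M' h i v.
by have /(congr1 (fun f : {linear _ -> _} => f v)) := ntr_nat h
  (LNpath (arrow_path i) : @hom (category_of (LN k N)) i (i + 1)).
Qed.

Program Definition to_ncomplex : functor (Mod (LN k N)) (NComplexes k N) :=
  @Functor (Mod (LN k N)) (NComplexes k N) ncomplex_of_module
    (fun M M' h => ncomplex_hom_of_module h) _ _.
Next Obligation. by move=> M; apply: ncomplex_hom_eq. Qed.
Next Obligation. by move=> *; apply: ncomplex_hom_eq. Qed.

Lemma module_of_ncomplexK (M : ncomplex k N) :
  ncomplex_of_module (module_of_ncomplex M) = M.
Proof.
case: M => A d dN; apply: ncomplex_eq => i v.
by rewrite [LHS]LNact_pi LactU.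
Qed.

Lemma ncomplex_of_moduleK (M : kmodule (LN k N)) :
  module_of_ncomplex (ncomplex_of_module M) = M.
Proof.
apply: kmodule_eq.
pose F := kmod_fun (module_of_ncomplex (ncomplex_of_module M)).
(* The object maps are convertible, so [erefl] makes the casts compute away. What remains is linear
   in a representative of [f] and is checked on paths. *)
apply: (@functor_eq _ _ F M (fun i => erefl (M i))) => i j f.
apply: linear_fun_eq => v; rewrite -[f]lquot_reprK; move: (lquot_repr f) => {}f.
rewrite [LHS]LNact_pi; move: f; apply: malg_linear_ext => [a f g|a f g|p].
- exact: Lact_linearl.
- by rewrite linearP; apply: kmod_lin.
by rewrite LactU; apply: path_act_module.
Qed.

Lemma to_moduleK : functor_comp to_ncomplex (to_module k N) = functor_id _.
Proof.
apply: (@functor_eq _ _ (functor_comp to_ncomplex (to_module k N)) (functor_id _)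
  module_of_ncomplexK) => M M' h.
apply: ncomplex_hom_eq => i v.
(* Both functors keep the components of [h], and the transports are identities on each space. *)
by have := hom_cast_ncomplex (module_of_ncomplexK M) (module_of_ncomplexK M')
  (fmor (functor_comp to_ncomplex (to_module k N)) h) v; rewrite !ob_cast_id.
Qed.

Lemma to_ncomplexK : functor_comp (to_module k N) to_ncomplex = functor_id _.
Proof.
apply: (@functor_eq _ _ (functor_comp (to_module k N) to_ncomplex) (functor_id _)
  ncomplex_of_moduleK) => M M' h.
apply: nat_trans_eq => i; apply: linear_fun_eq => v.
by have := hom_cast_kmodule (ncomplex_of_moduleK M) (ncomplex_of_moduleK M')
  (fmor (functor_comp (to_module k N) to_ncomplex) h) v; rewrite !ob_cast_id.
Qed.

End ComplexOfModule.

Theorem theorem2p1 (k : fieldType) (N : nat) (N_gt0 : (0 < N)%N) :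
  isomorphic_categories (NComplexes k N) (Mod (LN k N)).
Proof.
by exists (to_module k N), (to_ncomplex k N); split;
  [apply: to_moduleK | apply: to_ncomplexK].
Qed.
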